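(* Let $X, Y$ be Banach spaces over $\mathbb{K}$, let $k$ be a positive integer, and let $Q \in \mathcal{P}(^k X, Y)$ with $\|Q\|=1$. For every $P \in \mathcal{P}(^k X, Y)$, $$V(\mathcal{P}(^k X, Y), Q, P) = \operatorname{conv} V_Q(P).$$
   Context: $\mathbb{K}$ is $\mathbb{R}$ or $\mathbb{C}$. For a Banach space $X$ over $\mathbb{K}$, $X^*$ is the topological dual, $B_X$ the closed unit ball and $S_X$ the unit sphere. $\operatorname{conv} C$ is the convex hull (not closed) of $C$. A map $P:X\to Y$ is a $k$-homogeneous polynomial if there is a $k$-linear map $A:X^k\to Y$ with $P(x)=A(x,\dots,x)$ for all $x\in X$. $\mathcal{P}(^k X,Y)$ is the Banach space of continuous $k$-homogeneous polynomials from $X$ to $Y$ with norm $\|P\|=\sup_{x\in B_X}\|P(x)\|$. For $Q\in\mathcal{P}(^kX,Y)$ with $\|Q\|=1$ and $P\in\mathcal{P}(^kX,Y)$: - the intrinsic numerical range of $P$ with respect to $Q$ is $V(\mathcal{P}(^k X, Y), Q, P) := \{\phi(P) : \phi \in \mathcal{P}(^k X, Y)^*,\ \|\phi\| = \phi(Q) = 1\}$; - the approximated spatial numerical range of $P$ with respect to $Q$ is $V_Q(P) := \bigcap_{\delta > 0} \overline{\{y^*(P(x)) : y^* \in S_{Y^*},\ x \in S_X,\ \operatorname{Re} y^*(Q(x))>1-\delta\}}$. *)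

(* Defs.v *)
From HB Require Import structures.
From mathcomp Require Import all_boot all_order all_algebra.
From mathcomp Require Import complex.
From mathcomp Require Import all_classical all_reals all_analysis.

Set Implicit Arguments.
Unset Strict Implicit.
Unset Printing Implicit Defensive.

Import Order.TTheory GRing.Theory Num.Theory.
Import numFieldNormedType.Exports.

Local Open Scope classical_set_scope.
Local Open Scope ring_scope.

(* "K is R or C".  The norm of a normedModType K takes its values in K, whose
   order is only partial when K = C; [re] and [of_real] move between K and R,
   so that suprema can be taken in R. *)
Variant scalar_kind := RealScalars | ComplexScalars.

Definition scalar_field (R : realType) (F : scalar_kind) : numFieldType :=
  match F with RealScalars => R | ComplexScalars => complex R end.

Definition re (R : realType) (F : scalar_kind) : scalar_field R F -> R :=
  match F return scalar_field R F -> R with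
  | RealScalars => fun z => z
  | ComplexScalars => fun z => complex.Re z
  end.

Definition of_real (R : realType) (F : scalar_kind) : R -> scalar_field R F :=
  match F return R -> scalar_field R F with
  | RealScalars => fun r => r
  | ComplexScalars => fun r => real_complex R r
  end.
Arguments of_real R F r : clear implicits.

Section scalars.
Variables (R : realType) (F : scalar_kind).
Local Notation K := (scalar_field R F).
Local Notation ofr := (of_real R F).

Lemma re_of_real r : re (ofr r) = r.
Proof. by case: F. Qed.

Lemma of_realK (z : K) : 0 <= z -> ofr (re z) = z.
Proof.
case: F z => //= -[a b] /=.
by rewrite lecE/= => /andP[/eqP-> _].
Qed.

Lemma re_ofM r (z : K) : re (ofr r * z) = r * re z.
Proof. by case: F z => //= -[a b] /=; rewrite mul0r subr0. Qed.

Lemma of_realD r s : ofr (r + s) = ofr r + ofr s.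
Proof. by case: F => //=; rewrite rmorphD. Qed.

Lemma of_realM r s : ofr (r * s) = ofr r * ofr s.
Proof. by case: F => //=; rewrite rmorphM. Qed.

Lemma of_real0 : ofr 0 = 0.
Proof. by case: F. Qed.

Lemma le_of_real r s : (ofr r <= ofr s) = (r <= s).
Proof. by case: F => //=; rewrite lecR. Qed.

End scalars.

Section sup_norm.
Variables (R : realType) (F : scalar_kind).
Local Notation K := (scalar_field R F).

Definition rnorm (V : normedModType K) (v : V) : R := re `|v|.

Definition unit_ball (V : normedModType K) : set V := [set x | rnorm x <= 1].

Definition unit_sphere (V : normedModType K) : set V := [set x | rnorm x = 1].

(* The junk value [sup A = 0] for unbounded A is harmless below: the functions
   this is applied to are continuous polynomials and functionals. *)
Definition sup_norm (V W : normedModType K) (f : V -> W) : R :=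
  sup [set rnorm (f x) | x in @unit_ball V].

End sup_norm.
Arguments unit_ball {R F} V.
Arguments unit_sphere {R F} V.

Section rnorm_theory.
Variables (R : realType) (F : scalar_kind) (V : normedModType (scalar_field R F)).
Implicit Types v w : V.
Local Notation K := (scalar_field R F).
Local Notation ofr := (of_real R F).

Lemma of_rnorm v : ofr (rnorm v) = `|v|.
Proof. exact: of_realK. Qed.

Lemma rnorm_le v r : (rnorm v <= r) = (`|v| <= ofr r).
Proof. by rewrite -of_rnorm le_of_real. Qed.

Lemma rnorm_ge0 v : 0 <= rnorm v.
Proof. by rewrite -(le_of_real F) of_real0 of_rnorm. Qed.

Lemma rnormD v w : rnorm (v + w) <= rnorm v + rnorm w.
Proof. by rewrite rnorm_le of_realD !of_rnorm ler_normD. Qed.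

Lemma rnormZ (a : K) v : rnorm (a *: v) = re `|a| * rnorm v.
Proof. by rewrite /rnorm normrZ -re_ofM of_realK. Qed.

Lemma rnorm0 : rnorm (0 : V) = 0.
Proof. by rewrite /rnorm normr0 -(of_real0 R F) re_of_real. Qed.

Lemma rnorm_eq0 v : rnorm v = 0 -> v = 0.
Proof. by move=> v0; apply/normr0_eq0; rewrite -of_rnorm v0 of_real0. Qed.

End rnorm_theory.

Section polynomials.
Variables (R : realType) (F : scalar_kind).
Local Notation K := (scalar_field R F).
Variables (k : nat) (X Y : normedModType K).

(* [dfwith x i u] is the family x whose i-th entry has been replaced by u. *)
Definition multilinear (A : ('I_k -> X) -> Y) : Prop :=
  forall (x : 'I_k -> X) (i : 'I_k), linear (fun u : X => A (dfwith x i u)).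

Definition homogeneous_polynomial (P : X -> Y) : Prop :=
  exists2 A : ('I_k -> X) -> Y, multilinear A & forall x, P x = A (fun=> x).

Definition cpoly : {pred X -> Y} :=
  fun P => `[< continuous P /\ homogeneous_polynomial P >].

Lemma cpolyP P : reflect (continuous P /\ homogeneous_polynomial P) (P \in cpoly).
Proof. exact: asboolP. Qed.

Lemma cpoly_submod_closed : submod_closed cpoly.
Proof.
split=> [|a P Q /cpolyP[cP [A lA PA]] /cpolyP[cQ [B lB QB]]]; apply/cpolyP.
  split; first by move=> x; exact: cst_continuous.
  by exists (fun=> 0) => // x i a u v; rewrite scaler0 addr0.
split.
  move=> x; apply: (@cvgD _ _ _ _ _ (fun x => a *: P x) Q); last exact: cQ.
  by apply: cvgZr; exact: cP.
exists (fun x => a *: A x + B x) => [x i b u v|x]; last by rewrite -PA -QB.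
rewrite (lA x i b u v) (lB x i b u v) !scalerDr !scalerA (mulrC b).
by rewrite !addrA; congr (_ + _); rewrite addrAC.
Qed.

HB.instance Definition _ :=
  GRing.isSubmodClosed.Build K (X -> Y) cpoly cpoly_submod_closed.

Record polySpace := PolySpace {
  poly_fun :> X -> Y;
  poly_funP : poly_fun \in cpoly }.

HB.instance Definition _ := [isSub for poly_fun].
HB.instance Definition _ := gen_eqMixin polySpace.
HB.instance Definition _ := gen_choiceMixin polySpace.
HB.instance Definition _ := [SubChoice_isSubLmodule of polySpace by <:].

End polynomials.

Section polynomial_norm.
Variables (R : realType) (F : scalar_kind).
Local Notation K := (scalar_field R F).
Local Notation ofr := (of_real R F).
Variables (k : nat) (X Y : normedModType K).
Implicit Types P Q : polySpace k X Y.

Lemma multilinearZ (A : ('I_k -> X) -> Y) (a : K) (x : X) :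
  multilinear A -> A (fun=> a *: x) = a ^+ k *: A (fun=> x).
Proof.
move=> lA; pose y j := fun i : 'I_k => if (i < j)%N then a *: x else x.
suff H j : (j <= k)%N -> A (y j) = a ^+ j *: A (fun=> x).
  by rewrite -H//; congr A; apply/funext => i; rewrite /y ltn_ord.
elim: j => [_|j ih jk]; first by rewrite scale1r.
pose i0 := Ordinal jk.
have yS : y j.+1 = dfwith (y j) i0 (a *: x).
  apply/funext => i; case: dfwithP => [|i' ni]; first by rewrite /y ltnS leqnn.
  rewrite /y ltnS leq_eqVlt; case: eqP => //= ij.
  by case/eqP: ni; apply/val_inj.
have yj : y j = dfwith (y j) i0 x.
  by apply/funext => i; case: dfwithP => //; rewrite /y ltnn.
have A0 : A (dfwith (y j) i0 0) = 0.
  have := lA (y j) i0 1 0 0; rewrite !scale1r addr0 => /eqP.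
  by rewrite -subr_eq subrr eq_sym => /eqP.
have := lA (y j) i0 a x 0; rewrite addr0 A0 addr0 -yS -yj ih 1?ltnW// => ->.
by rewrite scalerA -exprS.
Qed.

Lemma polyZ P (a : K) (x : X) : P (a *: x) = a ^+ k *: P x.
Proof.
by have /cpolyP[_ [A lA PA]] := poly_funP P; rewrite !PA multilinearZ.
Qed.

Lemma poly_bounded P : exists M : R, forall x, unit_ball X x -> rnorm (P x) <= M.
Proof.
have /cpolyP[cP _] := poly_funP P.
have := cP 0 => /cvgrPdist_lt /(_ 1 ltr01) /nbhs_norm0P [e /= e0 He].
have e20 : 0 < e / 2 by rewrite divr_gt0.
have ek0 : 0 < (e / 2) ^+ k by rewrite exprn_gt0.
have P01 : 0 <= `|P 0| + 1 by rewrite addr_ge0.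
exists (re ((`|P 0| + 1) / (e / 2) ^+ k)) => x xB.
rewrite rnorm_le of_realK; last by rewrite divr_ge0// ltW.
rewrite ler_pdivlMr// -[X in _ * X]gtr0_norm//.
rewrite mulrC -normrZ -polyZ; set z := _ *: x.
have zP : `|P 0 - P z| < 1.
  apply: He => /=; rewrite /z normrZ gtr0_norm// (@le_lt_trans _ _ (e / 2))//.
    rewrite ger_pMr//; move: xB; rewrite /unit_ball/= rnorm_le.
    by rewrite (_ : ofr 1 = 1)//; case: F.
  by rewrite ltr_pdivrMr// ltr_pMr// ltr1n.
rewrite -[P z](subrK (P 0)) (le_trans (ler_normD _ _))// addrC lerD2l.
by rewrite distrC ltW.
Qed.

Lemma unit_ball0 : unit_ball X 0.
Proof. by rewrite /unit_ball/= rnorm0. Qed.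

Lemma sup_norm_ub P x : unit_ball X x -> rnorm (P x) <= sup_norm P.
Proof.
move=> xB; apply: ub_le_sup; last by exists x.
by have [M HM] := poly_bounded P; exists M => _ [y yB <-]; exact: HM.
Qed.

Lemma sup_norm_le P r :
  (forall x, unit_ball X x -> rnorm (P x) <= r) -> sup_norm P <= r.
Proof.
move=> H; apply: ge_sup; first by exists (rnorm (P 0)), 0 => //; exact: unit_ball0.
by move=> _ [x xB <-]; exact: H.
Qed.

Lemma sup_norm_ge0 P : 0 <= sup_norm P.
Proof. exact: le_trans (rnorm_ge0 _) (sup_norm_ub P unit_ball0). Qed.

Definition poly_norm P : K := ofr (sup_norm P).

Lemma poly_normD P Q : poly_norm (P + Q) <= poly_norm P + poly_norm Q.
Proof.
rewrite /poly_norm -of_realD le_of_real; apply: sup_norm_le => x xB.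
by rewrite (le_trans (rnormD _ _))// lerD// sup_norm_ub.
Qed.

Lemma sup_normZ_le (a : K) P : sup_norm (a *: P : polySpace k X Y) <= re `|a| * sup_norm P.
Proof.
apply: sup_norm_le => x xB; rewrite (_ : (a *: P) x = a *: P x)// rnormZ.
by rewrite ler_wpM2l ?sup_norm_ub// -(le_of_real F) of_real0 of_realK.
Qed.

Lemma poly_normZ (a : K) P : poly_norm (a *: P) = `|a| * poly_norm P.
Proof.
rewrite /poly_norm -[X in X * _]of_realK// -of_realM; congr ofr.
apply/eqP; rewrite eq_le sup_normZ_le andTb.
have [->|a0] := eqVneq a 0.
  have -> : re (`|0 : K|) = 0 by rewrite normr0; case: F.
  by rewrite mul0r sup_norm_ge0.
have a_gt0 : 0 < re `|a|.
  have : 0 <= re `|a| by rewrite -(le_of_real F) of_real0 of_realK.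
  rewrite le_eqVlt => /orP[/eqP h|//]; case/eqP: a0; apply/normr0_eq0.
  by rewrite -[LHS]of_realK// -h of_real0.
rewrite -ler_pdivlMl//; have := sup_normZ_le a^-1 (a *: P).
rewrite scalerA mulVf// scale1r.
suff -> : re `|a^-1| = (re `|a|)^-1 by [].
apply: (mulfI (lt0r_neq0 a_gt0)); rewrite divff ?lt0r_neq0//.
rewrite -re_ofM of_realK// normfV divff ?normr_eq0//.
by case: F.
Qed.

Lemma poly_norm0_eq0 P : poly_norm P = 0 -> P = 0.
Proof.
move=> /(congr1 (@re R F)); rewrite re_of_real (_ : re 0 = 0) => [P0|]; last by case: F.
apply/val_inj/funext => x; rewrite /= [RHS]/(0 : Y).
have [->|x0] := eqVneq x 0.
  apply/rnorm_eq0/le_anti; rewrite rnorm_ge0 andbT -P0 sup_norm_ub//.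
  exact: unit_ball0.
have nx0 : `|x| != 0 by rewrite normr_eq0.
have -> : x = `|x| *: (`|x|^-1 *: x) by rewrite scalerA divff// scale1r.
rewrite polyZ (rnorm_eq0 (v := P _)) ?scaler0//.
apply/le_anti; rewrite rnorm_ge0 andbT -P0 sup_norm_ub//.
rewrite /unit_ball/= rnorm_le normrZ normfV normr_id mulVf//.
by case: F.
Qed.

HB.instance Definition _ := Lmodule_isNormed.Build K (polySpace k X Y)
  poly_normD poly_normZ poly_norm0_eq0.

End polynomial_norm.

(* [smallest C A] is the intersection of all the sets in C that contain A.
   Over K = C the weights {i01 C} of [convex_set] are still the real numbers
   of [0, 1], because the order of C is partial. *)
Definition convex_hull (K : numFieldType) (E : lmodType K) (A : set E) : set E :=
  smallest (@convex_set K E) A.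

Section numerical_ranges.
Variables (R : realType) (F : scalar_kind).
Local Notation K := (scalar_field R F).

Definition dual_sphere (V : normedModType K) : set {linear V -> K^o} :=
  [set phi | continuous phi /\ sup_norm phi = 1].

Definition intrinsic_numerical_range (k : nat) (X Y : normedModType K)
    (Q P : polySpace k X Y) : set K^o :=
  [set phi P | phi in [set phi | @dual_sphere (polySpace k X Y) phi /\ phi Q = 1]].

Definition approx_spatial_numerical_range (k : nat) (X Y : normedModType K)
    (Q P : polySpace k X Y) : set K^o :=
  \bigcap_(delta in [set delta : R | 0 < delta])
    closure [set z : K^o | exists (ystar : {linear Y -> K^o}) (x : X),
      [/\ dual_sphere ystar, unit_sphere X x,
          re (ystar (Q x)) > 1 - delta & z = ystar (P x)]].

End numerical_ranges.

(* Main.v *)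
Require Import Defs.
From HB Require Import structures.
From mathcomp Require Import all_boot all_order all_algebra.
From mathcomp Require Import ring lra.
From mathcomp Require Import complex.
From mathcomp Require Import all_classical all_reals all_analysis.

Import Order.TTheory GRing.Theory Num.Theory.
Import numFieldNormedType.Exports.

Local Open Scope classical_set_scope.
Local Open Scope ring_scope.

Set Implicit Arguments.
Unset Strict Implicit.

(** Write V for the intrinsic range of P and S for the approximated spatial one.

    By the Hahn-Banach theorem a scalar z is a value phi(P) with
    ||phi|| = phi(Q) = 1 exactly when |a + b z| <= ||a Q + b P|| for all
    scalars a and b ([intrinsic_numerical_rangeP]): the functional that takes
    the values 1 and z at Q and P is then dominated by the norm on their span.
    This description shows at once that V is convex.  It also gives S <= V
    ([spatial_sub_intrinsic]): if y^*(Q x) has modulus at most 1 and real part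
    close to 1, it is close to 1, so that a + b z is almost
    y^*((a Q + b P)(x)), whose modulus is at most ||a Q + b P||.
    Hence conv S <= V.

    For the converse, fix z in V and a direction c.  For small t > 0,
    ||Q + t c P|| >= |1 + t c z| >= 1 + t Re(c z).  If y^* and x almost norm
    Q + t c P, up to t^2, then comparing with Re y^*(Q x) <= 1 gives
    Re(c y^*(P x)) > Re(c z) - t, while Re y^*(Q x) = 1 - O(t).  A cluster point
    w of the values y^*(P x) as t -> 0 therefore lies in S and satisfies
    Re(c w) >= Re(c z) ([spatial_support]): no closed half-plane that contains
    S misses z.  As S is compact, this forces z to be in the convex hull of S,
    without closure ([support_mem_triangles]): the union of all triangles with
    vertices in S is compact, and its point nearest to z has to be z.

    The real and the complex case are treated together: a scalar is handled
    through its coordinates [re] and [im], with [im] = 0 in the real case. *)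

(** * Coordinates of scalars *)

Definition im (R : realType) (F : scalar_kind) : scalar_field R F -> R :=
  match F return scalar_field R F -> R with
  | RealScalars => fun=> 0
  | ComplexScalars => fun z => complex.Im z
  end.

(** The zero of the real case makes z = re z + imag_unit * im z hold for both
    kinds of scalars. *)
Definition imag_unit (R : realType) (F : scalar_kind) : scalar_field R F :=
  match F return scalar_field R F with
  | RealScalars => 0
  | ComplexScalars => 'i%C
  end.
Arguments imag_unit : clear implicits.

Section scalars.
Variables (R : realType) (F : scalar_kind).
Local Notation K := (scalar_field R F).
Local Notation ofr := (of_real R F).
Implicit Types (z w : K) (r s : R).

Lemma re_im_inj z w : re z = re w -> im z = im w -> z = w.
Proof. by case: F z w => //= -[a b] [c d] /= -> ->. Qed.

Lemma reD z w : re (z + w) = re z + re w.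
Proof. by case: F z w => //= -[a b] [c d]. Qed.

Lemma imD z w : im (z + w) = im z + im w.
Proof. by case: F z w => [z w|[a b] [c d]] //=; rewrite addr0. Qed.

Lemma reN z : re (- z) = - re z.
Proof. by case: F z => //= -[a b]. Qed.

Lemma imN z : im (- z) = - im z.
Proof. by case: F z => [z|[a b]] //=; rewrite oppr0. Qed.

Lemma reM z w : re (z * w) = re z * re w - im z * im w.
Proof. by case: F z w => [z w|[a b] [c d]] //=; rewrite mul0r subr0. Qed.

Lemma imM z w : im (z * w) = re z * im w + im z * re w.
Proof. by case: F z w => [z w|[a b] [c d]] //=; rewrite mul0r mulr0 addr0. Qed.

Lemma im_of_real r : im (ofr r) = 0.
Proof. by case: F. Qed.

Lemma of_real1 : ofr 1 = 1.
Proof. by case: F. Qed.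

Lemma re_im_decomp z : z = ofr (re z) + imag_unit R F * ofr (im z).
Proof.
case: F z => [z|[a b]] /=; first by rewrite mul0r addr0.
rewrite /real_complex_def; apply/eqP; rewrite eq_complex /=.
by apply/andP; split; apply/eqP; ring.
Qed.

Lemma re_norm z : re `|z| = Num.sqrt (re z ^+ 2 + im z ^+ 2).
Proof.
case: F z => [z|[a b]] /=; last by [].
by rewrite expr0n /= addr0 sqrtr_sqr.
Qed.

(** The witness is the conjugate of z.  Half-planes can thus be described both by
    inner products and by real parts of products. *)
Lemma dot_scalar z : exists c, forall w, re (c * w) = re z * re w + im z * im w.
Proof.
case: F z => [z|z]; first by exists z => w /=; rewrite mul0r addr0.
by case: z => a b; exists (a -i* b)%C => -[c d] /=; rewrite mulNr opprK.
Qed.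

Lemma re_le_norm z : `|re z| <= re `|z|.
Proof. by rewrite re_norm -sqrtr_sqr ler_wsqrtr // lerDl sqr_ge0. Qed.

Lemma im_le_norm z : `|im z| <= re `|z|.
Proof. by rewrite re_norm -sqrtr_sqr ler_wsqrtr // lerDr sqr_ge0. Qed.

Lemma norm_of_real r : `|ofr r| = ofr `|r|.
Proof.
have n := normr_ge0 (ofr r); rewrite -[LHS]of_realK // re_norm re_of_real.
by rewrite im_of_real expr0n addr0 sqrtr_sqr.
Qed.

Lemma lt_of_real r s : (ofr r < ofr s) = (r < s).
Proof. by case: F => //=; rewrite ltcR. Qed.

Lemma re_gt0 z : 0 < z -> 0 < re z.
Proof. by move=> z0; rewrite -lt_of_real of_real0 of_realK // ltW. Qed.

Lemma re0 : re (0 : K) = 0. Proof. by case: F. Qed.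
Lemma im0 : im (0 : K) = 0. Proof. by case: F. Qed.
Lemma re1 : re (1 : K) = 1. Proof. by case: F. Qed.

End scalars.

Definition coordE := (reD, imD, reN, imN, reM, imM, re_of_real, im_of_real).

(** * Topology of the scalars *)

Section topology.
Variables (R : realType) (F : scalar_kind).
Local Notation K := (scalar_field R F).
Local Notation ofr := (of_real R F).

Lemma lipschitz1_continuous (V : normedModType K) (f : V -> R) :
  (forall x y, `|f x - f y| <= rnorm (x - y)) -> continuous f.
Proof.
move=> fL x; apply/cvgrPdist_lt => e e0.
have oe : 0 < ofr e by rewrite -of_real0 lt_of_real.
have /cvgrPdist_lt/(_ _ oe) : (y : V) @[y --> x] --> x by exact: cvg_id.
apply: filterS => y; rewrite -of_rnorm lt_of_real.
exact: le_lt_trans (fL _ _).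
Qed.

Lemma rnorm_continuous : continuous (@rnorm R F K^o).
Proof.
apply: lipschitz1_continuous => x y.
have := rnormD (x - y) y; have := rnormD (y - x) x; rewrite !subrK.
rewrite /rnorm [`|y - x|]distrC ler_norml => ? ?; apply/andP; split; lra.
Qed.

Lemma re_continuous : continuous (@re R F : K^o -> R).
Proof. by apply: lipschitz1_continuous => x y; rewrite -reN -reD re_le_norm. Qed.

Lemma im_continuous : continuous (@im R F : K^o -> R).
Proof. by apply: lipschitz1_continuous => x y; rewrite -imN -imD im_le_norm. Qed.

Lemma of_real_continuous : continuous (ofr : R -> K^o).
Proof.
move=> x; apply/cvgrPdist_lt => e e0.
have /cvgrPdist_lt/(_ _ (re_gt0 e0)) : (y : R) @[y --> x] --> x by exact: cvg_id.
apply: filterS => y xy.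
have -> : ofr x - ofr y = ofr (x - y).
  by apply: re_im_inj; rewrite !coordE // subrr.
by rewrite norm_of_real -(@of_realK _ F e) ?ltW // lt_of_real.
Qed.

Lemma closed_rnorm_le (M : R) : closed [set w : K^o | rnorm w <= M].
Proof.
have /continuous_closedP H := rnorm_continuous.
exact: (H _ (@closed_le _ M)).
Qed.

(** The square [-M, M] x [-M, M] is compact, and the scalars of norm at most M
    lie in its continuous image under (a, b) |-> a + i b. *)
Lemma bounded_closed_compact_scalar (S : set K^o) (M : R) :
  closed S -> (forall z, S z -> rnorm z <= M) -> compact S.
Proof.
move=> cS SM.
pose emb (x : R * R) : K^o := ofr x.1 + imag_unit R F * ofr x.2.
have cemb : continuous emb.
  move=> x; apply: cvgD.
    by apply: continuous_comp; [exact: cvg_fst | exact: of_real_continuous].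
  apply: cvgM; first exact: cvg_cst.
  by apply: continuous_comp; [exact: cvg_snd | exact: of_real_continuous].
apply: (@subclosed_compact _ S (emb @` (`[- M, M] `*` `[- M, M]))) => //.
  apply: continuous_compact; last by apply: compact_setX; exact: segment_compact.
  by apply: continuous_subspaceT.
move=> z /SM zM; exists (re z, im z); last by rewrite /emb /= -re_im_decomp.
rewrite /= !in_itv /= -!ler_norml.
by rewrite (le_trans (re_le_norm _) zM) (le_trans (im_le_norm _) zM).
Qed.

End topology.

(** * Convex hulls of compact sets of scalars *)

Section real_facts.
Variable R : realType.

Lemma opposite_signs_cancel (x y : R) : x * y <= 0 ->
  exists s, [/\ 0 <= s, s <= 1 & (1 - s) * x + s * y = 0].
Proof.
move=> xy; have [->|x0] := eqVneq x 0.
  by exists 0; rewrite mulr0 mul0r addr0 lexx ler01.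
have d0 : 0 < (x - y) ^+ 2.
  rewrite lt_neqAle sqr_ge0 andbT eq_sym sqrf_eq0 subr_eq0.
  apply/eqP => xy'; move: xy; rewrite -xy' -expr2 => h.
  by move: x0; rewrite -sqrf_eq0 eq_le sqr_ge0 h.
have d1 : x - y != 0 by rewrite -sqrf_eq0 gt_eqF.
exists (x / (x - y)); split.
- have -> : x / (x - y) = (x * (x - y)) / (x - y) ^+ 2 by field.
  by rewrite divr_ge0 ?sqr_ge0 //; nra.
- rewrite -subr_ge0.
  have -> : 1 - x / (x - y) = (- y * (x - y)) / (x - y) ^+ 2 by field.
  by rewrite divr_ge0 ?sqr_ge0 //; nra.
- by field.
Qed.

(** The inequality is that of the right derivative at 0 of a function that is
    minimal there; a negative b is refuted at t = |b| / M, small enough for the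
    linear term to win. *)
Lemma quadratic_min_at0 (b c : R) :
  (forall t, 0 <= t -> t <= 1 -> 0 <= 2 * t * b + t ^+ 2 * c) -> 0 <= b.
Proof.
move=> H; rewrite leNgt; apply/negP => b0.
pose M := `|c| + `|b| + 1.
have M0 : 0 < M by rewrite /M; have := normr_ge0 c; have := normr_ge0 b; lra.
have t0 : 0 < `|b| / M by rewrite divr_gt0 // normr_gt0 lt_eqF.
have t1 : `|b| / M <= 1.
  by rewrite ler_pdivrMr // mul1r /M; have := normr_ge0 c; lra.
have := H _ (ltW t0) t1; set t := `|b| / M in t0 t1 *.
have tM : t * M = - b by rewrite /t divfK ?gt_eqF // ltr0_norm.
have cM : c < M by rewrite /M; have := ler_norm c; have := normr_ge0 b; lra.
have : t * c < t * M by rewrite ltr_pM2l.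
move=> h; rewrite leNgt => /negP; apply; nra.
Qed.

End real_facts.

Section planar_hull.
Variables (R : realType) (F : scalar_kind).
Local Notation K := (scalar_field R F).
Local Notation ofr := (of_real R F).
Implicit Types (z w p q d : K) (S : set K^o).

(** Inner product and determinant of two scalars seen as plane vectors; in the
    real case [cross] vanishes and [dot] is the product. *)
Definition dot z w := re z * re w + im z * im w.
Definition cross z w := re z * im w - im z * re w.

Lemma dot_gt0 q : q != 0 -> 0 < dot q q.
Proof.
move=> q0; rewrite lt_neqAle eq_sym addr_ge0 ?andbT -?expr2 ?sqr_ge0 //.
rewrite paddr_eq0 ?sqr_ge0 // !sqrf_eq0.
apply: contraNN q0 => /andP[/eqP a /eqP b].
by apply/eqP/re_im_inj; rewrite ?a ?b ?re0 ?im0.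
Qed.

Lemma dot_cross_eq0 q d : q != 0 -> dot q d = 0 -> cross q d = 0 -> d = 0.
Proof.
move=> /dot_gt0 q0 dt cr; have q1 : dot q q != 0 by rewrite gt_eqF.
apply: re_im_inj; rewrite ?re0 ?im0; apply: (mulfI q1); rewrite mulr0.
  transitivity (re q * dot q d - im q * cross q d); last by rewrite dt cr; ring.
  by rewrite /dot /cross; ring.
transitivity (im q * dot q d + re q * cross q d); last by rewrite dt cr; ring.
by rewrite /dot /cross; ring.
Qed.

Lemma dotD q z w : dot q (z + w) = dot q z + dot q w.
Proof. by rewrite /dot !coordE; ring. Qed.

Lemma dotB q z w : dot q (z - w) = dot q z - dot q w.
Proof. by rewrite /dot !coordE; ring. Qed.

Lemma dotZ q r z : dot q (ofr r * z) = r * dot q z.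
Proof. by rewrite /dot !coordE; ring. Qed.

Lemma crossD q z w : cross q (z + w) = cross q z + cross q w.
Proof. by rewrite /cross !coordE; ring. Qed.

Lemma crossZ q r z : cross q (ofr r * z) = r * cross q z.
Proof. by rewrite /cross !coordE; ring. Qed.

(** The first two of three barycentric coordinates. *)
Definition weights : set (R * R) :=
  [set x | 0 <= x.1 /\ 0 <= x.2 /\ x.1 + x.2 <= 1].

Definition triangle_point (a b c : K^o) (x : R * R) : K^o :=
  ofr x.1 * a + ofr x.2 * b + ofr (1 - x.1 - x.2) * c.

(** The union of all triangles with vertices in S, written as the image of a
    product so that its compactness is visible.  By
    Caratheodory's theorem it is the convex hull of S. *)
Definition triangles S : set K^o :=
  [set triangle_point u.1.1.1 u.1.1.2 u.1.2 u.2
  | u in ((S `*` S) `*` S) `*` weights].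

Lemma weights_compact : compact weights.
Proof.
apply: (@subclosed_compact (R * R)%type weights (`[0, 1] `*` `[0, 1])).
- rewrite (_ : weights = (fst @^-1` [set x | 0 <= x]) `&`
     ((snd @^-1` [set x | 0 <= x]) `&`
      ((fun x : R * R => x.1 + x.2) @^-1` [set x | x <= 1]))) //.
  apply: closedI; last apply: closedI.
  + apply: (@closed_comp _ _ (@fst R R)); last exact: closed_ge.
    by move=> x _; exact: cvg_fst.
  + apply: (@closed_comp _ _ (@snd R R)); last exact: closed_ge.
    by move=> x _; exact: cvg_snd.
  + apply: closed_comp; last exact: closed_le.
    by move=> x _; apply: cvgD; [exact: cvg_fst | exact: cvg_snd].
- by apply: compact_setX; exact: segment_compact.
- move=> [x y] [/= x0 [y0 xy]]; rewrite /= !in_itv /=.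
  by split; apply/andP; split; lra.
Qed.

Lemma triangles_compact S : compact S -> compact (triangles S).
Proof.
move=> cS; apply: continuous_compact; last first.
  by do !apply: compact_setX => //; exact: weights_compact.
apply: continuous_subspaceT => u.
pose T := ((K^o * K^o * K^o) * (R * R))%type.
have cfst (A B : topologicalType) (f : T -> A * B) :
    continuous f -> continuous (fun u => (f u).1).
  by move=> cf v; apply: (@continuous_comp _ _ _ f fst v (cf v)); exact: cvg_fst.
have csnd (A B : topologicalType) (f : T -> A * B) :
    continuous f -> continuous (fun u => (f u).2).
  by move=> cf v; apply: (@continuous_comp _ _ _ f snd v (cf v)); exact: cvg_snd.
have cid : continuous (@id T) by move=> v; exact: cvg_id.
have cofr (f : T -> R) :
    continuous f -> continuous (fun u => ofr (f u) : K^o).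
  move=> cf v; apply: (@continuous_comp _ _ _ f (ofr : R -> K^o)); first exact: cf.
  exact: of_real_continuous.
apply: cvgD; [apply: cvgD|].
- apply: cvgM; first exact: (cofr _ (cfst _ _ _ (csnd _ _ _ cid))).
  exact: (cfst _ _ _ (cfst _ _ _ (cfst _ _ _ cid))).
- apply: cvgM; first exact: (cofr _ (csnd _ _ _ (csnd _ _ _ cid))).
  exact: (csnd _ _ _ (cfst _ _ _ (cfst _ _ _ cid))).
- apply: cvgM; last exact: (csnd _ _ _ (cfst _ _ _ cid)).
  apply: cofr => v; apply: cvgB; last exact: (csnd _ _ _ (csnd _ _ _ cid)).
  by apply: cvgB; [exact: cvg_cst|exact: (cfst _ _ _ (csnd _ _ _ cid))].
Qed.

Lemma convex_set_comb (H : set K^o) t z w : convex_set H -> 0 <= t -> t <= 1 ->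
  H z -> H w -> H (ofr t * z + ofr (1 - t) * w).
Proof.
move=> cH t0 t1 Hz Hw.
have ot0 : 0 <= ofr t by rewrite -(of_real0 R F) le_of_real.
have ot1 : ofr t <= 1 by rewrite -(of_real1 R F) le_of_real.
have -> : ofr (1 - t) = 1 - ofr t.
  by apply: re_im_inj; rewrite !coordE -(of_real1 R F) !coordE ?subrr.
by have := cH z w (Itv01 ot0 ot1); rewrite !inE; apply.
Qed.

Lemma triangles_sub_convex (S H : set K^o) :
  convex_set H -> S `<=` H -> triangles S `<=` H.
Proof.
move=> cH SH _ [[[[a b] c] [x y]] [[[/= Sa Sb] Sc] [x0 [y0 xy]]] <-].
rewrite /= in x0 y0 xy *; rewrite /triangle_point /=.
have [x1|x1] := eqVneq x 1.
  have -> : y = 0 by lra.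
  by rewrite x1 !subrr of_real0 of_real1 !mul0r mul1r !addr0; exact: SH.
have x1' : 0 < 1 - x by rewrite subr_gt0 lt_neqAle x1 /=; lra.
have x1n : 1 - x != 0 by rewrite gt_eqF.
have -> : ofr x * a + ofr y * b + ofr (1 - x - y) * c =
   ofr x * a +
   ofr (1 - x) * (ofr (y / (1 - x)) * b + ofr (1 - y / (1 - x)) * c).
  rewrite mulrDr !mulrA -!of_realM addrA.
  congr (_ + ofr _ * _ + ofr _ * _); field; exact: x1n.
have xle1 : x <= 1 by lra.
have u0 : 0 <= y / (1 - x) by exact: divr_ge0 y0 (ltW x1').
have u1 : y / (1 - x) <= 1.
 by rewrite ler_pdivrMr // mul1r; lra.
have hbc := convex_set_comb cH u0 u1 (SH _ Sb) (SH _ Sc).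
exact: (convex_set_comb cH x0 xle1 (SH _ Sa) hbc).
Qed.


Lemma mem_triangles S a b c (x y z : R) : S a -> S b -> S c ->
  0 <= x -> 0 <= y -> 0 <= z -> x + y + z = 1 ->
  triangles S (ofr x * a + ofr y * b + ofr z * c).
Proof.
move=> Sa Sb Sc x0 y0 z0 xyz; exists (((a, b), c), (x, y)).
  by do !split => //=; lra.
by rewrite /triangle_point /= (_ : 1 - x - y = z) //; lra.
Qed.

(** The hypothesis says that no closed half-plane containing S misses z.  Let p
    be the point nearest to z among all triangles with vertices in S, and
    suppose q = p - z is nonzero.  From p one cannot move inside the triangles
    in a direction that makes a negative inner product with q; but some w in S
    lies strictly on the z side of p.  So p is not on a segment with ends in S,
    since otherwise the segment from p to w would lie in a triangle.  Hence p is
    interior to a triangle, whose vertices must all be on the line through p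
    orthogonal to q; two of them are then on opposite sides of p, so that p is
    on a segment after all. *)
Lemma support_mem_triangles S z : compact S ->
  (forall c, exists2 w, S w & re (c * z) <= re (c * w)) -> triangles S z.
Proof.
move=> cS supp.
have supp' q : exists2 w, S w & dot q (w - z) <= 0.
  have [c cE] := dot_scalar q; have [w Sw cw] := supp (- c); exists w => //.
  by move: cw; rewrite dotB !mulNr !reN !cE subr_le0 lerN2.
have T0 : triangles S !=set0.
  have [w Sw _] := supp 0; exists (ofr 1 * w + ofr 0 * w + ofr 0 * w).
  by apply: mem_triangles => //; lra.
pose f (w : K^o) : R :=
  (re w - re z) * (re w - re z) + (im w - im z) * (im w - im z).
have fE w : f w = dot (w - z) (w - z) by rewrite /f /dot !coordE.
have cf : {within triangles S, continuous f}.
  apply: continuous_subspaceT => w.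
  have cst (r : R) : continuous (fun _ : K^o => r).
    by move=> v; exact: cst_continuous.
  have cr := @continuousB R R K^o _ _ w (@re_continuous R F w) (cst (re z) w).
  have ci := @continuousB R R K^o _ _ w (@im_continuous R F w) (cst (im z) w).
  exact: continuousD (continuousM cr cr) (continuousM ci ci).
have [p /set_mem Tp pmin] := compact_EVT_min T0 (triangles_compact cS) cf.
have [/eqP|] := eqVneq (p - z) 0; first by rewrite subr_eq0 => /eqP <-.
set q := p - z => q0; exfalso.
have qq := dot_gt0 q0.
have seg s :
    (forall t, 0 <= t -> t <= 1 -> triangles S (p + ofr t * (s - p))) ->
    0 <= dot q (s - p).
  move=> Hs; suff H : forall t, 0 <= t -> t <= 1 ->
      0 <= 2 * t * dot q (s - p) + t ^+ 2 * dot (s - p) (s - p).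
    exact: quadratic_min_at0 H.
  move=> t t0 t1; have := pmin _ (mem_set (Hs t t0 t1)); rewrite !fE -/q.
  have -> : p + ofr t * (s - p) - z = q + ofr t * (s - p) by rewrite /q; ring.
  by rewrite /dot !coordE; lra.
have [w Sw qw] := supp' q.
have wp : dot q (w - p) < 0.
  have -> : w - p = (w - z) - q by rewrite /q; ring.
  by rewrite dotB; lra.
have no_segment a b (x y : R) : S a -> S b -> 0 <= x -> 0 <= y -> x + y = 1 ->
    p = ofr x * a + ofr y * b -> False.
  move=> Sa Sb x0 y0 xy pE; suff : 0 <= dot q (w - p) by lra.
  apply: seg => t t0 t1.
  have -> : p + ofr t * (w - p) =
      ofr ((1 - t) * x) * a + ofr ((1 - t) * y) * b + ofr t * w.
    by rewrite pE; apply: re_im_inj; rewrite !coordE; ring.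
  by apply: mem_triangles => //; nra.
have vertex a b c (x y r : R) :
    S a -> S b -> S c -> 0 <= x -> 0 <= y -> 0 <= r ->
    x + y + r = 1 -> p = ofr x * a + ofr y * b + ofr r * c ->
    0 <= dot q (a - p).
  move=> Sa Sb Sc x0 y0 r0 xyr pE; apply: seg => t t0 t1.
  have -> : p + ofr t * (a - p) = ofr ((1 - t) * x + t) * a +
      ofr ((1 - t) * y) * b + ofr ((1 - t) * r) * c.
    by rewrite pE; apply: re_im_inj; rewrite !coordE; ring.
  by apply: mem_triangles => //; nra.
have [[[[a b] c] [x y]] /= [[[Sa Sb] Sc] [x0 [y0 xy]]]] := Tp.
rewrite /= in x0 y0 xy *; rewrite /triangle_point /= => /esym.
have : x + y + (1 - x - y) = 1 by ring.
have : 0 <= 1 - x - y by lra.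
move: (1 - x - y) => r r0 xyr pE.
have [x_0|xn0] := eqVneq x 0.
  apply: (no_segment b c y r) => //; first by lra.
  by rewrite pE x_0 of_real0 mul0r add0r.
have [y_0|yn0] := eqVneq y 0.
  apply: (no_segment a c x r) => //; first by lra.
  by rewrite pE y_0 of_real0 mul0r addr0.
have [r_0|rn0] := eqVneq r 0.
  apply: (no_segment a b x y) => //; first by lra.
  by rewrite pE r_0 of_real0 mul0r addr0.
have xp : 0 < x by rewrite lt_neqAle eq_sym xn0.
have yp : 0 < y by rewrite lt_neqAle eq_sym yn0.
have rp : 0 < r by rewrite lt_neqAle eq_sym rn0.
have da : 0 <= dot q (a - p) by exact: (vertex a b c x y r).
have db : 0 <= dot q (b - p).
  by apply: (vertex b a c y x r) => //; [lra | rewrite pE; ring].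
have dc : 0 <= dot q (c - p).
  by apply: (vertex c a b r x y) => //; [lra | rewrite pE; ring].
have bary g : (forall u v, g (u + v) = g u + g v) ->
    (forall s u, g (ofr s * u) = s * g u) ->
    x * g (a - p) + y * g (b - p) + r * g (c - p) = 0.
  move=> gD gZ; rewrite -!gZ -!gD.
  rewrite (_ : _ + _ = ofr 0 * 0) ?gZ ?mul0r //.
  rewrite pE (_ : r = 1 - x - y); last by lra.
  by apply: re_im_inj; rewrite !coordE; ring.
have dsum := bary _ (dotD q) (dotZ q).
have csum := bary _ (crossD q) (crossZ q).
have [pa pb pc] : [/\ 0 <= x * dot q (a - p), 0 <= y * dot q (b - p) &
    0 <= r * dot q (c - p)] by split; exact: mulr_ge0.
have cancel (s d : R) : 0 < s -> s * d = 0 -> d = 0.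
  by move=> s0 /eqP; rewrite mulf_eq0 gt_eqF //= => /eqP.
have da0 : dot q (a - p) = 0 by apply: (cancel _ _ xp); lra.
have db0 : dot q (b - p) = 0 by apply: (cancel _ _ yp); lra.
have dc0 : dot q (c - p) = 0 by apply: (cancel _ _ rp); lra.
have same_side u v : S u -> S v ->
    dot q (u - p) = 0 -> dot q (v - p) = 0 ->
    cross q (u - p) * cross q (v - p) <= 0 -> False.
  move=> Su Sv du dv /opposite_signs_cancel [s [s0 s1 sE]].
  have s1' : 0 <= 1 - s by rewrite subr_ge0.
  apply: (no_segment u v (1 - s) s _ _ s1' s0 (subrK _ _)) => //.
  apply/eqP; rewrite eq_sym -subr_eq0; apply/eqP.
  have -> : ofr (1 - s) * u + ofr s * v - p =
      ofr (1 - s) * (u - p) + ofr s * (v - p).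
    by apply: re_im_inj; rewrite !coordE; ring.
  apply: (dot_cross_eq0 q0); last by rewrite crossD !crossZ.
  by rewrite dotD !dotZ du dv !mulr0 addr0.
(* All three determinants have the same sign, against their weighted sum 0. *)
have [ab|ab] := leP (cross q (a - p) * cross q (b - p)) 0.
  exact: (same_side a b).
have [ac|ac] := leP (cross q (a - p) * cross q (c - p)) 0.
  exact: (same_side a c).
have an0 : cross q (a - p) != 0.
  by apply/eqP => h; move: ab; rewrite h mul0r ltxx.
have aa : 0 < cross q (a - p) * cross q (a - p).
  by rewrite -expr2 lt_neqAle sqr_ge0 eq_sym sqrf_eq0 an0.
suff : 0 < cross q (a - p) * 0 by rewrite mulr0 ltxx.
rewrite -[X in _ * X]csum.
rewrite [ltRHS](_ : _ = x * (cross q (a - p) * cross q (a - p)) +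
  y * (cross q (a - p) * cross q (b - p)) +
  r * (cross q (a - p) * cross q (c - p))); last by ring.
by rewrite !addr_gt0 // mulr_gt0.
Qed.

End planar_hull.

(** * Sublinear functionals and the Hahn-Banach theorem *)

Section sublinear.
Variables (R : realType) (F : scalar_kind).
Local Notation K := (scalar_field R F).
Local Notation ofr := (of_real R F).
Variable V : lmodType K.
Implicit Types (p q : V -> R) (u v w : V).

Definition sublinear p :=
  (forall u v, p (u + v) <= p u + p v) /\
  (forall t v, 0 <= t -> p (ofr t *: v) <= t * p v).

Lemma sublinear0 p : sublinear p -> p 0 = 0.
Proof.
move=> [pD pZ]; apply/eqP; rewrite eq_le; apply/andP; split.
  by have := pZ 0 0 (lexx _); rewrite of_real0 scale0r mul0r.
by have := pD 0 0; rewrite addr0; lra.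
Qed.

Lemma sublinearN p v : sublinear p -> - p (- v) <= p v.
Proof.
move=> sp; have := sp.1 v (- v); rewrite subrr sublinear0 //; lra.
Qed.

Definition scaling_cone (C : set (V * R)) :=
  [/\ C (0, 0),
      forall x y, C x -> C y -> C (x.1 + y.1, x.2 + y.2) &
      forall t x, 0 <= t -> C x -> C (ofr t *: x.1, t * x.2)].

(** The largest sublinear functional below p that is at most -r at -w for each
    (w, r) in C.  Taking C to be a half-line shows that minimal sublinear
    functionals are additive; taking C to be the graph of a linear form on a
    subspace, that the form extends. *)
Definition inf_conv p (C : set (V * R)) v : R :=
  inf [set p (v + x.1) - x.2 | x in C].

Section inf_conv_theory.
Variables (p : V -> R) (C : set (V * R)).
Hypotheses (sp : sublinear p) (cC : scaling_cone C)
  (Cp : forall x, C x -> x.2 <= p x.1).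

Let lb v : has_lbound [set p (v + x.1) - x.2 | x in C].
Proof.
exists (- p (- v)) => _ [x Cx <-].
have := sp.1 (v + x.1) (- v); rewrite addrAC subrr add0r.
have := Cp Cx; lra.
Qed.

Let ne v : [set p (v + x.1) - x.2 | x in C] !=set0.
Proof. by case: cC => C0 _ _; exists (p (v + 0) - 0), (0, 0). Qed.

Lemma inf_conv_le v x : C x -> inf_conv p C v <= p (v + x.1) - x.2.
Proof. by move=> Cx; apply: ge_inf => //; exists x. Qed.

Lemma inf_conv_le_fun v : inf_conv p C v <= p v.
Proof. by case: cC => C0 _ _; have := inf_conv_le v C0; rewrite addr0 subr0. Qed.

Lemma inf_conv_opp x : C x -> inf_conv p C (- x.1) <= - x.2.
Proof.
by move=> Cx; have := inf_conv_le (- x.1) Cx; rewrite addNr sublinear0 // sub0r.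
Qed.

Lemma inf_conv_sublinear : sublinear (inf_conv p C).
Proof.
case: (cC) => C0 CD CZ; split => [u v|t v t0].
- rewrite -lerBlDr; apply: lb_le_inf => // _ [x Cx <-].
  rewrite lerBlDr -lerBlDl; apply: lb_le_inf => // _ [y Cy <-].
  rewrite lerBlDr; apply: le_trans (inf_conv_le _ (CD _ _ Cx Cy)) _ => /=.
  have := sp.1 (u + x.1) (v + y.1); rewrite addrACA; lra.
- move: t0; rewrite le_eqVlt => /predU1P[<-|t0].
    by rewrite of_real0 scale0r mul0r (le_trans (inf_conv_le_fun _)) ?sublinear0.
  rewrite -ler_pdivrMl //; apply: lb_le_inf => // _ [x Cx <-].
  rewrite ler_pdivrMl //.
  apply: le_trans (inf_conv_le _ (CZ t x (ltW t0) Cx)) _ => /=.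
  by rewrite -scalerDr mulrBr lerD2r sp.2 // ltW.
Qed.
End inf_conv_theory.

(** Apply the infimal convolution to the half-line spanned by (v, q v).  By
    minimality this gives q back, and it is at most q (u + v) - q v at u. *)
Lemma minimal_sublinear_additive q : sublinear q ->
  (forall q', sublinear q' -> (forall v, q' v <= q v) -> q' = q) ->
  forall u v, q (u + v) = q u + q v.
Proof.
move=> sq qmin u v; apply/eqP; rewrite eq_le sq.1 /=.
pose C : set (V * R) :=
  [set x | exists2 t, 0 <= t & x = (ofr t *: v, q (ofr t *: v))].
have qZ t w : 0 <= t -> q (ofr t *: w) = t * q w.
  rewrite le_eqVlt => /predU1P[<-|t0].
    by rewrite of_real0 scale0r mul0r sublinear0.
  apply/eqP; rewrite eq_le sq.2 ?(ltW t0) //= -ler_pdivlMl //.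
  have t1 : 0 <= t^-1 by rewrite invr_ge0 ltW.
  have := sq.2 t^-1 (ofr t *: w) t1.
  by rewrite scalerA -of_realM mulVf ?gt_eqF // of_real1 scale1r.
have cC : scaling_cone C.
  split => [|_ _ [t t0 ->] [s s0 ->]|t _ t0 [s s0 ->]] /=.
  - by exists 0; rewrite // of_real0 scale0r sublinear0.
  - exists (t + s); first by rewrite addr_ge0.
    by rewrite !qZ ?addr_ge0 // of_realD scalerDl mulrDl.
  - exists (t * s); first by rewrite mulr_ge0.
    by rewrite !qZ ?mulr_ge0 // of_realM scalerA mulrA.
have Cq x : C x -> x.2 <= q x.1 by move=> [t t0 ->].
have <- := qmin _ (inf_conv_sublinear sq cC Cq) (inf_conv_le_fun sq cC Cq).
have C1 : C (v, q v) by exists 1 => //; rewrite of_real1 scale1r.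
have := inf_conv_le sq Cq u C1 => /=.
rewrite (qmin _ (inf_conv_sublinear sq cC Cq) (inf_conv_le_fun sq cC Cq)); lra.
Qed.

(** By Zorn's lemma: the pointwise infimum of a chain is finite, as every
    sublinear f <= p satisfies f v >= - p (- v), and it is subadditive because
    of two members of the chain one is the smaller everywhere. *)
Lemma exists_minimal_sublinear p : sublinear p ->
  exists q, [/\ sublinear q, forall v, q v <= p v &
  forall q', sublinear q' -> (forall v, q' v <= q v) -> q' = q].
Proof.
move=> sp; pose T := {q : V -> R | sublinear q /\ forall v, q v <= p v}.
pose leT (f g : T) : bool := `[< forall v, sval g v <= sval f v >].
have leTP f g : reflect (forall v, sval g v <= sval f v) (leT f g).
  exact: asboolP.
have [||||[q [sq qp]] qmax] := @Zorn T leT.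
- by move=> f; apply/leTP.
- by move=> f g h /leTP fg /leTP gh; apply/leTP => v; exact: le_trans (fg v).
- move=> [f Hf] [g Hg] /leTP fg /leTP gf; apply: eq_exist => /=.
  by apply/funext => v; apply/eqP; rewrite eq_le fg gf.
- move=> A Atot.
  have [->|/set0P[f0 Af0]] := eqVneq A set0.
    by exists (exist _ p (conj sp (fun v => lexx _))).
  pose q v := inf [set sval f v | f in A].
  have ne v : [set sval f v | f in A] !=set0 by exists (sval f0 v), f0.
  have lb v : has_lbound [set sval f v | f in A].
    exists (- p (- v)) => _ [[f [sf fp]] _ <-] /=.
    by apply: le_trans (sublinearN v sf); rewrite lerN2.
  have qle f v : A f -> q v <= sval f v by move=> Af; apply: ge_inf => //; exists f.
  have sq : sublinear q.
    split => [u v|t v t0].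
    - rewrite -lerBlDr; apply: lb_le_inf => // _ [f Af <-].
      rewrite lerBlDr -lerBlDl; apply: lb_le_inf => // _ [g Ag <-].
      rewrite lerBlDl; have [/leTP fg|/leTP gf] := Atot _ _ Af Ag.
      + apply: le_trans (qle g _ Ag) _; apply: le_trans ((svalP g).1.1 u v) _.
        by rewrite lerD2r fg.
      + apply: le_trans (qle f _ Af) _; apply: le_trans ((svalP f).1.1 u v) _.
        by rewrite lerD2l gf.
    - move: t0; rewrite le_eqVlt => /predU1P[<-|t0].
        rewrite of_real0 scale0r mul0r; apply: le_trans (qle _ _ Af0) _.
        by rewrite sublinear0 //; exact: (svalP f0).1.
      rewrite -ler_pdivrMl //; apply: lb_le_inf => // _ [f Af <-].
      rewrite ler_pdivrMl //; apply: le_trans (qle _ _ Af) _.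
      by apply: (svalP f).1.2; exact: ltW.
  have qp v : q v <= p v by apply: le_trans (qle _ v Af0) _; exact: (svalP f0).2.
  exists (exist _ q (conj sq qp)) => f Af; apply/leTP => v; exact: qle.
- exists q; split => // q' sq' q'q.
  have q'p v : q' v <= p v by exact: le_trans (qp v).
  pose f' : T := exist _ q' (conj sq' q'p).
  have leqf' : leT (exist _ q (conj sq qp)) f' by apply/leTP => v; exact: q'q.
  by have /(congr1 sval) := qmax f' leqf'.
Qed.

(** The Hahn-Banach theorem: g is a minimal sublinear functional below the
    infimal convolution of p and C. *)
Lemma sublinear_dominated_extension p (C : set (V * R)) :
  sublinear p -> scaling_cone C -> (forall x, C x -> x.2 <= p x.1) ->
  exists g : V -> R, [/\ forall u v, g (u + v) = g u + g v,
    forall t v, g (ofr t *: v) = t * g v,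
    forall v, g v <= p v & forall x, C x -> x.2 <= g x.1].
Proof.
move=> sp cC Cp.
have [g [sg gp gmin]] := exists_minimal_sublinear (inf_conv_sublinear sp cC Cp).
have gD := minimal_sublinear_additive sg gmin.
have gN v : g (- v) = - g v.
  by apply/eqP; rewrite -addr_eq0 -gD addNr sublinear0.
have gZ t v : 0 <= t -> g (ofr t *: v) = t * g v.
  move=> t0; apply/eqP; rewrite eq_le sg.2 //= -[leRHS]opprK -gN -scalerN.
  by rewrite lerNr -mulrN -gN sg.2.
exists g; split => // [t v|v|x Cx].
- have [t0|t0] := leP 0 t; first exact: gZ.
  rewrite -[t]opprK mulNr -gZ ?oppr_ge0 ?ltW // -gN -scaleNr.
  by congr (g (_ *: _)); apply: re_im_inj; rewrite !coordE ?oppr0.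
- exact: le_trans (gp v) (inf_conv_le_fun sp cC Cp v).
- by rewrite -lerN2 -gN; apply: le_trans (gp _) (inf_conv_opp sp Cp Cx).
Qed.

End sublinear.

(** * Functionals over the scalar field *)

Section functionals.
Variables (R : realType) (F : scalar_kind).
Local Notation K := (scalar_field R F).
Local Notation ofr := (of_real R F).

(** A rotation of v makes its value real and nonnegative. *)
Lemma norm_le_of_re_le (V : normedModType K) (phi : {linear V -> K^o}) v :
  (forall v, re (phi v) <= rnorm v) -> rnorm (phi v) <= rnorm v.
Proof.
move=> H; have [->|p0] := eqVneq (phi v) 0; first by rewrite rnorm0 rnorm_ge0.
pose a : K := `|phi v| / phi v.
have := H (a *: v); rewrite linearZ /= rnormZ.
have -> : a *: phi v = `|phi v| by rewrite /a /GRing.scale /= divfK.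
rewrite /a normrM normfV normr_id divff ?normr_eq0 // re1 mul1r.
by rewrite {1}/rnorm.
Qed.

(** In the complex case phi v = g v - i g (i v). *)
Lemma real_functional_complexify (V : normedModType K) (g : V -> R) :
  (forall u v, g (u + v) = g u + g v) ->
  (forall t v, g (ofr t *: v) = t * g v) ->
  exists phi : {linear V -> K^o}, forall v, re (phi v) = g v.
Proof.
move: V g; case: F => V g gD gZ.
  have lg : linear (g : V -> (R : realType)^o) by move=> a u v; rewrite gD gZ.
  pose G := GRing.isLinear.Build _ _ _ _
    (g : V -> (scalar_field R RealScalars)^o) lg.
  pose phi : {linear V -> (scalar_field R RealScalars)^o} :=
    HB.pack (g : V -> (scalar_field R RealScalars)^o) G.
  by exists phi.
pose f (v : V) : complex R := (g v -i* g ('i%C *: v))%C.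
have lf : linear (f : V -> (scalar_field R ComplexScalars)^o).
  move=> [a b] u v; rewrite /f.
  have gN w : g (- w) = - g w.
    have := gZ (-1) w; rewrite mulN1r => <-; congr g.
    rewrite -scaleN1r; congr (_ *: _).
    by apply/eqP; rewrite eq_complex /= oppr0 !eqxx.
  have cE w : g ((a +i* b)%C *: w) = a * g w + b * g ('i%C *: w).
    rewrite -!gZ -gD; congr g; rewrite scalerA -scalerDl; congr (_ *: _).
    by apply/eqP; rewrite eq_complex /=; apply/andP; split; apply/eqP; ring.
  have ciE w : g ('i%C *: ((a +i* b)%C *: w)) = a * g ('i%C *: w) - b * g w.
    rewrite -mulNr -!gZ -gD; congr g; rewrite !scalerA -scalerDl; congr (_ *: _).
    by apply/eqP; rewrite eq_complex /=; apply/andP; split; apply/eqP; ring.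
  rewrite scalerDr !gD cE ciE; apply/eqP; rewrite eq_complex /=.
  by apply/andP; split; apply/eqP; ring.
pose G := GRing.isLinear.Build _ _ _ _
  (f : V -> (scalar_field R ComplexScalars)^o) lf.
pose phi : {linear V -> (scalar_field R ComplexScalars)^o} :=
  HB.pack (f : V -> (scalar_field R ComplexScalars)^o) G.
by exists phi.
Qed.

Lemma re_mul_inj (z w : K) : (forall a, re (a * z) = re (a * w)) -> z = w.
Proof.
move=> H; apply/eqP; rewrite -subr_eq0; apply/eqP.
have [a aE] := dot_scalar (z - w).
have : re (a * (z - w)) = 0 by rewrite mulrBr reD reN H subrr.
rewrite aE => /eqP.
rewrite paddr_eq0 -?expr2 ?sqr_ge0 // !sqrf_eq0 => /andP[/eqP r0 /eqP i0].
by apply: re_im_inj; rewrite ?r0 ?i0 ?re0 ?im0.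
Qed.

(** The pairs (a u + b v, Re (a + b z)) form a cone below the norm.  The lower
    bounds that this cone imposes for (a, b) and for (-a, -b) together fix the
    values at u and v. *)
Lemma two_point_extension (V : normedModType K) (u v : V) (z : K) :
  (forall a b : K, `|a + b * z| <= `|a *: u + b *: v|) ->
  exists phi : {linear V -> K^o},
    [/\ forall x, rnorm (phi x) <= rnorm x, phi u = 1 & phi v = z].
Proof.
move=> H.
have sp : sublinear (@rnorm R F V).
  split => [x y|t x t0]; first exact: rnormD.
  by rewrite rnormZ norm_of_real re_of_real ger0_norm.
pose C : set (V * R) :=
  [set x | exists a b : K, x = (a *: u + b *: v, re (a + b * z))].
have cC : scaling_cone C.
  split => [|_ _ [a [b ->]] [c [d ->]]|t _ _ [a [b ->]]] /=.
  - by exists 0, 0; rewrite !scale0r mul0r !addr0 re0.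
  - exists (a + c), (b + d); rewrite !scalerDl addrACA -reD.
    by congr (_, re _); ring.
  - exists (ofr t * a), (ofr t * b); rewrite scalerDr !scalerA; congr (_, _).
    by rewrite -re_ofM; congr re; ring.
have Cp x : C x -> x.2 <= rnorm x.1.
  move=> [a [b ->]] /=; apply: le_trans (ler_norm _) _.
  apply: le_trans (re_le_norm _) _.
  by rewrite rnorm_le of_realK.
have [g [gD gZ gp gC]] := sublinear_dominated_extension sp cC Cp.
have [phi phig] := real_functional_complexify gD gZ.
have phi_ge (a b : K) : re (a + b * z) <= re (a * phi u + b * phi v).
  have -> : a * phi u + b * phi v = phi (a *: u + b *: v).
    by rewrite linearD !linearZ.
  by rewrite phig; apply: (gC (a *: u + b *: v, re (a + b * z))); exists a, b.
have phiC (a b : K) : re (a * phi u + b * phi v) = re (a + b * z).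
  apply/eqP; rewrite eq_le phi_ge andbT.
  by have := phi_ge (- a) (- b); rewrite !mulNr -!opprD !reN lerN2.
exists phi; split.
- by move=> x; apply: norm_le_of_re_le => y; rewrite phig.
- by apply: re_mul_inj => a; have := phiC a 0; rewrite !mul0r !addr0 mulr1.
- by apply: re_mul_inj => b; have := phiC 0 b; rewrite !mul0r !add0r.
Qed.

End functionals.

Section dual_sphere.
Variables (R : realType) (F : scalar_kind).
Local Notation K := (scalar_field R F).
Local Notation ofr := (of_real R F).
Variable V : normedModType K.
Implicit Types (phi : {linear V -> K^o}).

(** As the supremum defining [sup_norm phi] is 1 and not the default value 0, it
    is the supremum of a bounded set. *)
Lemma dual_sphere_le phi v : dual_sphere phi -> rnorm (phi v) <= rnorm v.
Proof.
move=> [_ n1]; pose A := [set rnorm (phi x) | x in unit_ball V].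
have sA : has_sup A.
  apply: contrapT => /sup_out; rewrite -/(sup_norm phi) => n0.
  by move: n1; rewrite [sup_norm phi]n0 => /eqP; rewrite eq_sym oner_eq0.
have [->|v0] := eqVneq v 0; first by rewrite linear0 !rnorm0.
have nv0 : `|v| != 0 by rewrite normr_eq0.
have vE : v = `|v| *: (`|v|^-1 *: v) by rewrite scalerA divff // scale1r.
have uB : unit_ball V (`|v|^-1 *: v).
  by rewrite /unit_ball /= /rnorm normrZ normfV normr_id mulVf // re1.
rewrite {1}vE linearZ /= rnormZ normr_id -[leRHS]mulr1 ler_wpM2l ?rnorm_ge0 //.
by rewrite -n1; apply: ub_le_sup; [exact: sA.2|exists (`|v|^-1 *: v)].
Qed.

Lemma dual_sphere_intro phi u : (forall v, rnorm (phi v) <= rnorm v) ->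
  unit_sphere V u -> rnorm (phi u) = 1 -> dual_sphere phi.
Proof.
move=> le_phi u1 phiu; split.
  move=> x; apply/cvgrPdist_lt => e e0.
  have /cvgrPdist_lt/(_ _ e0) : (y : V) @[y --> x] --> x by exact: cvg_id.
  apply: filterS => y; apply: le_lt_trans.
  by rewrite -linearB -!of_rnorm le_of_real.
have ub : ubound [set rnorm (phi x) | x in unit_ball V] 1.
  by move=> _ [x xB <-]; exact: le_trans (le_phi x) xB.
have mem : [set rnorm (phi x) | x in unit_ball V] 1.
  by exists u => //; rewrite /unit_ball /= u1.
apply/eqP; rewrite eq_le; apply/andP; split.
  by apply: ge_sup => //; exists 1.
by apply: ub_le_sup => //; exists 1.
Qed.

(** The vector u is there to make V nonzero: when v = 0, a functional that norms
    u is taken. *)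
Lemma norming_functional (v u : V) : unit_sphere V u ->
  exists2 phi : {linear V -> K^o}, dual_sphere phi & phi v = `|v|.
Proof.
move=> u1.
have norming (w : V) : w != 0 ->
    exists2 phi : {linear V -> K^o}, dual_sphere phi & phi w = `|w|.
  move=> w0; have nw0 : `|w| != 0 by rewrite normr_eq0.
  pose e := `|w|^-1 *: w.
  have e1 : unit_sphere V e.
    by rewrite /unit_sphere /= /rnorm normrZ normfV normr_id mulVf // re1.
  have [|phi [phi_le phie _]] := @two_point_extension R F V e e 1.
    move=> a b; rewrite mulr1 -scalerDl normrZ.
    by rewrite -[`|e|]of_rnorm e1 of_real1 mulr1.
  exists phi.
    by apply: (dual_sphere_intro phi_le e1); rewrite phie /rnorm normr1 re1.
  have wE : w = `|w| *: e by rewrite scalerA divff // scale1r.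
  by rewrite {1}wE linearZ /= phie /GRing.scale /= mulr1.
have [->|v0] := eqVneq v 0; last exact: norming.
have [|phi dphi _] := norming u; last by exists phi; rewrite // linear0 normr0.
apply/eqP => u0; move: u1; rewrite /unit_sphere /= u0 rnorm0 => /eqP.
by rewrite eq_sym oner_eq0.
Qed.

End dual_sphere.

(** * The intrinsic numerical range contains the convex hull *)

Section numerical_range.
Variables (R : realType) (F : scalar_kind).
Local Notation K := (scalar_field R F).
Local Notation ofr := (of_real R F).
Variables (X Y : normedModType K) (k : nat).
Implicit Types P Q : polySpace k X Y.

Lemma rnorm_poly P : rnorm P = sup_norm P.
Proof. by rewrite /rnorm re_of_real. Qed.

Lemma rnorm_poly_sphere P x : unit_sphere X x -> rnorm (P x) <= rnorm P.
Proof.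
by move=> x1; rewrite rnorm_poly; apply: sup_norm_ub; rewrite /unit_ball /= x1.
Qed.

Lemma sphere_functional_le (ystar : {linear Y -> K^o}) P x :
  dual_sphere ystar -> unit_sphere X x -> rnorm (ystar (P x) : K^o) <= rnorm P.
Proof.
by move=> yS xS; apply: le_trans (dual_sphere_le _ yS) (rnorm_poly_sphere _ xS).
Qed.

(** By the Hahn-Banach theorem, a form with the values 1 at Q and z at P extends
    as soon as it is dominated by the norm on the span of Q and P. *)
Lemma intrinsic_numerical_rangeP Q P z : `|Q| = 1 ->
  intrinsic_numerical_range Q P z <->
  forall a b : K, `|a + b * z| <= `|a *: Q + b *: P|.
Proof.
move=> Q1; split.
  move=> [phi [dphi phiQ] <-] a b.
  have -> : a + b * phi P = phi (a *: Q + b *: P).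
    by rewrite linearD !linearZ /= phiQ /GRing.scale /= mulr1.
  by have := dual_sphere_le (a *: Q + b *: P) dphi; rewrite rnorm_le of_rnorm.
move=> /two_point_extension [phi [phi_le phiQ phiP]].
exists phi => //; split => //.
apply: (dual_sphere_intro phi_le (u := Q)).
  by rewrite /unit_sphere /= /rnorm Q1 re1.
by rewrite phiQ /rnorm normr1 re1.
Qed.

Lemma intrinsic_numerical_range_convex Q P : `|Q| = 1 ->
  convex_set (intrinsic_numerical_range Q P).
Proof.
move=> Q1 z w lambda; rewrite !inE.
move=> /(intrinsic_numerical_rangeP _ _ Q1) Hz.
move=> /(intrinsic_numerical_rangeP _ _ Q1) Hw.
apply/(intrinsic_numerical_rangeP _ _ Q1) => a b.
have l0 : 0 <= lambda%:num by exact: ge0.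
have l1 : lambda%:num <= 1 by exact: le1.
set l := lambda%:num in l0 l1.
have -> : a + b * (conv lambda z w) = l * (a + b * z) + (1 - l) * (a + b * w).
  rewrite (_ : conv lambda z w = l * z + (1 - l) * w) //; ring.
apply: le_trans (ler_normD _ _) _; have l10 : 0 <= 1 - l by rewrite subr_ge0.
rewrite !normrM (ger0_norm l0) (ger0_norm l10).
rewrite [leRHS](_ : _ = l * `|a *: Q + b *: P| +
  (1 - l) * `|a *: Q + b *: P|); last by ring.
by apply: lerD; apply: ler_wpM2l.
Qed.

Lemma spatial_sub_intrinsic Q P : `|Q| = 1 ->
  approx_spatial_numerical_range Q P `<=` intrinsic_numerical_range Q P.
Proof.
move=> Q1 z Hz; apply/(intrinsic_numerical_rangeP _ _ Q1) => a b.
rewrite -[leRHS]of_rnorm -[leLHS](@of_rnorm R F K^o) le_of_real.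
apply/ler_addgt0Pr => e e0.
pose C := re `|a| + re `|b| + 1.
have a0 : 0 <= re `|a| := rnorm_ge0 (a : K^o).
have b0 : 0 <= re `|b| := rnorm_ge0 (b : K^o).
have C0 : 0 < C by rewrite /C; lra.
pose d := e / C; have d0 : 0 < d by rewrite divr_gt0.
have dd : 0 < d ^+ 2 / 2 by rewrite divr_gt0 // exprn_gt0.
have /(_ (ball (z : K^o) (ofr d))) := Hz _ dd.
have od0 : 0 < ofr d by rewrite -(of_real0 R F) lt_of_real.
move=> /(_ (nbhsx_ballx (z : K^o) _ od0)) [w [[ystar [x [yS xS reQ ->]]]]].
rewrite -ball_normE /= -[`|_|](@of_rnorm R F K^o) lt_of_real => zw.
set u := ystar (Q x) in reQ.
have nu : rnorm u <= 1.
  by have := sphere_functional_le Q yS xS; rewrite -/u [rnorm Q]/rnorm Q1 re1.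
(* |u| <= 1 and Re u > 1 - d^2 / 2 give
   |1 - u|^2 <= 2 (1 - Re u) < d^2. *)
have u1 : rnorm (1 - u : K^o) <= d.
  rewrite /rnorm re_norm -[leRHS](ger0_norm (ltW d0)) -sqrtr_sqr.
  rewrite ler_sqrt ?sqr_ge0 //.
  move: nu; rewrite /rnorm re_norm => nu.
  have : re u ^+ 2 + im u ^+ 2 <= 1.
    have s0 : 0 <= re u ^+ 2 + im u ^+ 2 by rewrite addr_ge0 ?sqr_ge0.
    by rewrite -(sqr_sqrtr s0) -[leRHS](expr1n _ 2) lerXn2r ?nnegrE ?sqrtr_ge0.
  rewrite !coordE re1 (_ : im (1 : K) = 0); last by case: (F).
  rewrite add0r sqrrN; move: reQ; nra.
have key : rnorm (a * u + b * ystar (P x) : K^o) <= rnorm (a *: Q + b *: P).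
  have := sphere_functional_le (a *: Q + b *: P) yS xS.
  by rewrite [_ x](_ : _ = a *: Q x + b *: P x) // linearD !linearZ.
have -> : a + b * z = (a * u + b * ystar (P x)) +
    (a * (1 - u) + b * (z - ystar (P x))) by ring.
apply: le_trans (@rnormD R F K^o _ _) _; apply: lerD => //.
apply: le_trans (@rnormD R F K^o _ _) _.
rewrite (@rnormZ R F K^o) (@rnormZ R F K^o).
have eC : e = d * C by rewrite /d divfK // gt_eqF.
have := rnorm_ge0 (1 - u : K^o); have := rnorm_ge0 (z - ystar (P x) : K^o).
rewrite eC /C; nra.
Qed.

End numerical_range.

(** * The convex hull contains the intrinsic numerical range *)

Section support.
Variables (R : realType) (F : scalar_kind).
Local Notation K := (scalar_field R F).
Local Notation ofr := (of_real R F).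
Variables (X Y : normedModType K) (k : nat).
Implicit Types P Q G : polySpace k X Y.

Lemma spatial_bounded Q P z :
  approx_spatial_numerical_range Q P z -> rnorm (z : K^o) <= rnorm P.
Proof.
move=> /(_ 1 ltr01) Hz.
apply: (@closed_rnorm_le R F (rnorm P)); apply: closureS Hz.
by move=> _ [ystar [x [yS xS _ ->]]]; exact: sphere_functional_le.
Qed.

Lemma spatial_compact Q P : compact (approx_spatial_numerical_range Q P).
Proof.
apply: (@bounded_closed_compact_scalar _ _ _ (rnorm P)); last exact: spatial_bounded.
by apply: closed_bigI => d _; exact: closed_closure.
Qed.

(** Moving x from the ball to the sphere can only increase the norm of G x, by
    homogeneity of positive degree; the nonnegative r rules out x = 0. *)
Lemma almost_norming G (r : R) : (0 < k)%N -> 0 <= r -> r < rnorm G ->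
  exists (ystar : {linear Y -> K^o}) (x : X),
    [/\ dual_sphere ystar, unit_sphere X x & r < re (ystar (G x))].
Proof.
move=> k0 r0 rG.
have [x xB rx] : exists2 x, unit_ball X x & r < rnorm (G x).
  apply: contrapT => H; move: rG; rewrite ltNge => /negP; apply.
  rewrite rnorm_poly; apply: sup_norm_le => x xB; rewrite leNgt; apply/negP => h.
  by apply: H; exists x.
have Gx0 : G x != 0 by apply/eqP => h; move: rx; rewrite h rnorm0 ltNge r0.
have x0 : x != 0.
  apply/eqP => h; move: Gx0; rewrite h.
  by rewrite -(scale0r (0 : X)) polyZ expr0n gtn_eqF // scale0r eqxx.
have nx0 : `|x| != 0 by rewrite normr_eq0.
pose e := `|x|^-1 *: x.
have e1 : unit_sphere X e.
  by rewrite /unit_sphere /= /rnorm normrZ normfV normr_id mulVf // re1.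
have [f1] : exists u : Y, unit_sphere Y u.
  exists (`|G x|^-1 *: G x).
  by rewrite /unit_sphere /= /rnorm normrZ normfV normr_id mulVf ?re1 // normr_eq0.
move=> /(norming_functional (G e)) [ystar yS yG]; exists ystar, e; split => //.
rewrite yG -/(rnorm (G e)); apply: lt_le_trans rx _.
have -> : x = `|x| *: e by rewrite scalerA divff // scale1r.
rewrite polyZ rnormZ normrX normr_id.
have -> : re (`|x| ^+ k) = rnorm x ^+ k.
  rewrite -[`|x|]of_rnorm; elim: k => [|n ih]; first by rewrite !expr0 re1.
  by rewrite !exprS re_ofM ih.
by rewrite ler_piMl ?rnorm_ge0 // exprn_ile1 ?rnorm_ge0.
Qed.

(** The pair (ystar, x) almost norms Q + t c P, up to t^2; the hypothesis that
    t M is small makes 1 + t Re (c z) - t^2 nonnegative. *)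
Lemma perturbed_norming Q P z c (M t : R) : (0 < k)%N -> `|Q| = 1 ->
  intrinsic_numerical_range Q P z ->
  `|re (c * z)| + re `|c| * rnorm P + 1 <= M -> 0 < t -> t * M < 2^-1 ->
  exists (ystar : {linear Y -> K^o}) (x : X),
    [/\ dual_sphere ystar, unit_sphere X x,
       1 - 2 * (t * M) < re (ystar (Q x)) &
       re (c * z) - t < re (c * ystar (P x))].
Proof.
move=> k0 Q1 /(intrinsic_numerical_rangeP _ _ Q1) Hz hM t0 tM.
have nc : 0 <= re `|c| := rnorm_ge0 (c : K^o).
have cP0 : 0 <= re `|c| * rnorm P by rewrite mulr_ge0 ?rnorm_ge0.
have cz := ler_norm (re (c * z)).
have cz' := ler_norm (- re (c * z)); rewrite normrN in cz'.
have M1 : 1 <= M by have := normr_ge0 (re (c * z)); lra.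
have tt : t * t <= t by nra.
pose G : polySpace k X Y := (1 : K) *: Q + (ofr t * c) *: P.
have nG : 1 + t * re (c * z) <= rnorm G.
  have := Hz 1 (ofr t * c).
  rewrite -[leRHS]of_rnorm -[leLHS](@of_rnorm R F K^o) le_of_real.
  apply: le_trans; apply: le_trans (re_le_norm _); apply: le_trans (ler_norm _).
  by rewrite reD re1 -mulrA re_ofM.
have r0 : 0 <= 1 + t * re (c * z) - t * t by nra.
have rG : 1 + t * re (c * z) - t * t < rnorm G by nra.
have [ystar [x [yS xS]]] := almost_norming k0 r0 rG.
have -> : ystar (G x) = ystar (Q x) + ofr t * (c * ystar (P x)).
  rewrite [G x](_ : _ = 1 *: Q x + (ofr t * c) *: P x) // linearD !linearZ /=.
  by rewrite /GRing.scale /= mul1r mulrA.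
rewrite reD re_ofM => H.
have yQ : re (ystar (Q x)) <= 1.
  apply: le_trans (ler_norm _) _; apply: le_trans (re_le_norm _) _.
  by have := sphere_functional_le Q yS xS; rewrite [rnorm Q]/rnorm Q1 re1.
have yP : re (c * ystar (P x)) <= re `|c| * rnorm P.
  apply: le_trans (ler_norm _) _; apply: le_trans (re_le_norm _) _.
  rewrite normrM -[`|c|](@of_rnorm R F K^o) re_ofM re_of_real.
  by rewrite ler_wpM2l //; exact: (sphere_functional_le P yS xS).
by exists ystar, x; split => //; nra.
Qed.

(** The witness is a cluster point, as t -> 0+, of the values at P provided by
    [perturbed_norming]. *)
Lemma spatial_support Q P z c : (0 < k)%N -> `|Q| = 1 ->
  intrinsic_numerical_range Q P z ->
  exists2 w, approx_spatial_numerical_range Q P w & re (c * z) <= re (c * w).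
Proof.
move=> k0 Q1 Vz.
pose M := `|re (c * z)| + re `|c| * rnorm P + 1.
have M0 : 0 < M.
  have c0 : 0 <= re `|c| := rnorm_ge0 (c : K^o).
  by rewrite /M ltr_wpDl ?addr_ge0 ?mulr_ge0 ?rnorm_ge0.
have /choice[f Hf] : forall t, exists w : K, 0 < t -> t * M < 2^-1 ->
    exists (ystar : {linear Y -> K^o}) (x : X),
    [/\ dual_sphere ystar, unit_sphere X x, w = ystar (P x),
       1 - 2 * (t * M) < re (ystar (Q x)) & re (c * z) - t < re (c * w)].
  move=> t; have [t0|t0] := ltP 0 t; last by exists 0.
  have [tM|tM] := ltP (t * M) 2^-1; last by exists 0.
  have [ystar [x [yS xS yQ yP]]] := perturbed_norming k0 Q1 Vz (lexx M) t0 tM.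
  by exists (ystar (P x)) => _ _; exists ystar, x.
have near0 d : 0 < d -> \forall t \near (0 : R)^'+, 0 < t /\ t * M < d.
  move=> d0; near=> t; split; first by near: t; exact: nbhs_right_gt.
  by rewrite -ltr_pdivlMr //; near: t; apply: nbhs_right_lt; rewrite divr_gt0.
have cB : compact [set w : K^o | rnorm w <= rnorm P].
  apply: (@bounded_closed_compact_scalar _ _ _ (rnorm P)) => //.
  exact: closed_rnorm_le.
have half : 0 < 2^-1 :> R by rewrite invr_gt0.
have pF : ProperFilter (fmap (f : R -> K^o) (0 : R)^'+).
  by apply: fmap_proper_filter; exact: at_right_proper_filter.
have [|w [_]] := cB _ pF.
  apply: filterS (near0 _ half) => t [t0 tM].
  have [ys [x [yS xS fE _ _]]] := Hf t t0 tM.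
  by rewrite /= fE; exact: sphere_functional_le.
rewrite clusterE => Hw; exists w.
  move=> d d0; apply: Hw.
  have [d1 d1d dhalf] : exists2 d1, d1 <= d / 2 & 0 < d1 /\ d1 <= 2^-1.
    exists (Num.min (d / 2) 2^-1); rewrite ?ge_min ?lexx // ?orbT.
    by rewrite lt_min half divr_gt0.
  apply: filterS (near0 _ dhalf.1) => t [t0 tM].
  have [ys [x [yS xS fE HQ _]]] := Hf t t0 (lt_le_trans tM dhalf.2).
  by exists ys, x; split => //; lra.
apply/ler_addgt0Pr => e e0; rewrite -lerBlDr.
have cc : continuous (fun w : K^o => re (c * w)).
  move=> v; apply: (@continuous_comp _ _ _ (fun w : K^o => c * w : K^o) (@re R F)).
    by apply: (@mulrl_continuous K).
  exact: re_continuous.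
have {cc} /continuous_closedP cc := cc.
have cl := cc _ (@closed_ge _ (re (c * z) - e)).
apply: cl; apply: Hw.
apply: filterS (filterI (near0 _ half) (@nbhs_right_lt R 0 e e0)).
move=> t [[t0 tM] te].
have [ys [x [_ _ _ _ H]]] := Hf t t0 tM.
by rewrite /= ltW //; apply: le_lt_trans H; rewrite lerD2l lerN2 ltW.
Unshelve. all: by end_near. Qed.

End support.

Unset Implicit Arguments.

Theorem proposition2p3 (R : realType) (F : scalar_kind)
    (X Y : completeNormedModType (scalar_field R F)) (k : nat)
    (k_gt0 : (0 < k)%N) (Q : polySpace k X Y) (normQ : `|Q| = 1)
    (P : polySpace k X Y) :
  intrinsic_numerical_range Q P =
  convex_hull (approx_spatial_numerical_range Q P).
Proof.
apply/seteqP; split=> z.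
  move=> Vz H [cH SH]; apply: (triangles_sub_convex cH SH).
  apply: support_mem_triangles; first exact: spatial_compact.
  by move=> c; exact: spatial_support.
apply; split; first exact: intrinsic_numerical_range_convex.
exact: spatial_sub_intrinsic.
Qed.
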